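(* Let $G_1$ be the group of formal power series of the form $1+x\mathbb{Q}[[x]]$ for the pointwise multiplication product, let $G_2=\mathbb{Q}^*$ be the multiplicative group, and let $G_2$ act on $G_1$ by substitution, $\lambda\cdot f(x)=f(\lambda x)$. The group $\mathsf{G}_{\operatorname{Mu}}$ is isomorphic to the semi-direct product $G_2\ltimes G_1$.
   Context: The product in $G_2\ltimes G_1$ is $(\lambda,f(x))(\theta,g(x))=(\lambda\theta,f(\theta x)g(x))$. The operad $\operatorname{Mu}$ is the symmetric operad in $\mathbb{Q}$-vector spaces which is the quotient of the operad $\operatorname{PreLie}$ of labeled rooted trees by the ideal spanned by the labeled trees that are not corollas (a corolla being a rooted tree in which every chain of adjacent vertices starting at the root has at most two vertices). Explicitly, $\operatorname{Mu}(0)=0$ and for $n\ge1$ the space $\operatorname{Mu}(n)$ has dimension $n$, with basis $\mu^n_1,\dots,\mu^n_n$, where $\mu^n_i$ is the image of the corolla with $n$ vertices labeled by $\{1,\dots,n\}$ and root labeled by $i$; $\mathfrak{S}_n$ acts by permuting the labels; $\mu^1_1$ is the unit; and composition is given by $$\mu^n_i\circ_i\mu^\ell_j=\mu^{n+\ell-1}_{i+j-1},\qquad \mu^n_i\circ_h\mu^\ell_j=0\ \text{ for } h\neq i \text{ and } \ell\ge2 .$$ For an augmented operad $\mathcal{P}$ (a symmetric operad in $\mathbb{Q}$-vector spaces with $\mathcal{P}(0)=\{0\}$ and $\mathcal{P}(1)=\mathbb{Q}e$, $e$ the unit), let $\gamma$ be its composition map, $\langle\,\cdot\,\rangle$ the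 quotient map to coinvariants $\mathcal{P}(n)_{\mathfrak{S}_n}$, and $\widehat{\mathcal{P}}=\prod_{n\ge1}\mathcal{P}(n)_{\mathfrak{S}_n}$. For $x=\sum_m x_m$, $y=\sum_n y_n$ in $\widehat{\mathcal{P}}$ with any representatives $\bar{x}_m,\bar{y}_n$ of their components in $\mathcal{P}$, put $$x\times y=\sum_{m\ge1}\ \sum_{n_1,\dots,n_m\ge1}\langle\gamma(\bar{x}_m,\bar{y}_{n_1},\dots,\bar{y}_{n_m})\rangle .$$ This is independent of the choices and makes $\widehat{\mathcal{P}}$ an associative monoid with unit the image of $e$; $\mathsf{G}_{\mathcal{P}}$ is its group of invertible elements. *)

(* Defs.v *)
From HB Require Import structures.
From mathcomp Require Import all_boot all_order all_fingroup all_algebra.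
From mathcomp Require Import ring_quotient.
From mathcomp Require Import boolp.

Set Implicit Arguments.
Unset Strict Implicit.
Unset Printing Implicit Defensive.

Import GRing.Theory.
Local Open Scope ring_scope.
Local Open Scope quotient_scope.

(** Symmetric operads *)

(* When inputs [0, .., m - 1] are replaced by blocks of [n 0, .., n (m - 1)]
   inputs, with [k] inputs in total, the [j]-th input of the [i]-th block gets
   number [n 0 + .. + n (i - 1) + j] (see [inpE]). *)
Definition inp m (n : 'I_m -> nat) k (e : (\sum_i n i)%N = k)
  (i : 'I_m) (j : 'I_(n i)) : 'I_k := cast_ord e (tagnat.Rank i j).

Lemma inpE m (n : 'I_m -> nat) k (e : (\sum_i n i)%N = k) i (j : 'I_(n i)) :
  inp e j = (\sum_(h < m | (h < i)%N) n h + j)%N :> nat.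
Proof. exact: tagnat.RankEsum. Qed.

(* The arity of a composite is an index [k] together with a proof that it is
   the sum of the arities of the arguments, so that no transport is needed in
   the axioms. Inputs are numbered from 0. The element [opact x s] is [x] with
   the label [i] replaced by [s i]; as [(s * t) i = t (s i)] in ['S_n], this is
   the usual left action by relabelling. In the two equivariance axioms [u] is
   the permutation of the [k] inputs induced by a permutation [s] of the
   blocks, resp. by permutations [t i] inside the blocks. *)
Record operad := Operad {
  opmod :> nat -> lmodType rat;
  opact : forall n, opmod n -> 'S_n -> opmod n;
  opunit : opmod 1;
  opgamma : forall m (n : 'I_m -> nat) k, (\sum_i n i)%N = k ->
    opmod m -> (forall i, opmod (n i)) -> opmod k;
  opact_linear : forall n a (x y : opmod n) s,
    opact (a *: x + y) s = a *: opact x s + opact y s;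
  opact1 : forall n (x : opmod n), opact x 1%g = x;
  opactM : forall n (x : opmod n) s t,
    opact x (s * t)%g = opact (opact x s) t;
  opgamma_linearl : forall m n k (e : (\sum_(i < m) n i)%N = k) a x x' y,
    opgamma e (a *: x + x') y = a *: opgamma e x y + opgamma e x' y;
  opgamma_linearr : forall m n k (e : (\sum_(i < m) n i)%N = k)
      i0 a x (y y1 y2 : forall i, opmod (n i)),
    (forall i, i != i0 -> y i = y1 i /\ y i = y2 i) ->
    y i0 = a *: y1 i0 + y2 i0 ->
    opgamma e x y = a *: opgamma e x y1 + opgamma e x y2;
  opgamma_unitl : forall k (e : (\sum_(i < 1) k)%N = k) (y : opmod k),
    opgamma (n := fun=> k) e opunit (fun=> y) = y;
  opgamma_unitr : forall m (e : (\sum_(i < m) 1)%N = m) (x : opmod m),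
    opgamma (n := fun=> 1%N) e x (fun=> opunit) = x;
  opgammaA : forall m (n : 'I_m -> nat) k (e : (\sum_i n i)%N = k)
      (p : 'I_k -> nat) l (ep : (\sum_a p a)%N = l)
      (r : 'I_m -> nat) (er : forall i, (\sum_j p (inp e (i := i) j))%N = r i)
      (e' : (\sum_i r i)%N = l) x y (z : forall a, opmod (p a)),
    opgamma ep (opgamma e x y) z =
    opgamma e' x (fun i => opgamma (er i) (y i) (fun j => z (inp e j)));
  opgamma_actl : forall m (n : 'I_m -> nat) k (e : (\sum_i n i)%N = k)
      (s : 'S_m) (es : (\sum_i n (s i))%N = k) (u : 'S_k) x
      (y : forall i, opmod (n i)),
    (forall i (j : 'I_(n (s i))), u (inp es (i := i) j) = inp e j) ->
    opgamma e (opact x s) y = opact (opgamma es x (fun i => y (s i))) u;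
  opgamma_actr : forall m (n : 'I_m -> nat) k (e : (\sum_i n i)%N = k)
      (t : forall i, 'S_(n i)) (u : 'S_k) x (y : forall i, opmod (n i)),
    (forall i (j : 'I_(n i)), u (inp e j) = inp e (t i j)) ->
    opgamma e x (fun i => opact (y i) (t i)) = opact (opgamma e x y) u
}.

Record augOperad := AugOperad {
  aug_operad :> operad;
  aug0 : forall x : aug_operad 0, x = 0;
  aug1 : forall x : aug_operad 1, exists a, x = a *: opunit aug_operad;
  aug_unit_neq0 : opunit aug_operad != 0
}.

(** The partial composite [x \circ_i y] *)

Definition opins m (i : 'I_m) l : 'I_m -> nat :=
  fun h => if h == i then l else 1%N.

Definition opcirc (P : operad) m (i : 'I_m) l k (e : (\sum_h opins i l h)%N = k)
    (x : P m) (y : P l) : P k :=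
  opgamma e x (fun h =>
    if h == i as b return P (if b then l else 1%N) then y else opunit P).

(** The group of an augmented operad *)

Section Coinvariants.
Variables (P : operad) (n : nat).

(* As the action is linear, the finite sums of elements [x s - x] already form
   a Q-subspace. *)
Definition coinv_ker : {pred P n} := fun v =>
  `[< exists r : seq (P n * 'S_n),
        v = \sum_(xs <- r) (opact xs.1 xs.2 - xs.1) >].

Lemma opactN (x : P n) s : opact (- x) s = - opact x s.
Proof.
have act0 : opact (0 : P n) s = 0.
  by have := opact_linear (-1) (0 : P n) 0 s; rewrite scaler0 addr0 scaleN1r addNr.
by rewrite -[- x]addr0 -scaleN1r opact_linear act0 addr0 scaleN1r.
Qed.

Lemma coinv_ker_zmod : zmod_closed coinv_ker.
Proof.
split; first by apply/asboolP; exists [::]; rewrite big_nil.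
move=> x y /asboolP[r ->] /asboolP[r' ->]; apply/asboolP.
exists (r ++ [seq (- xs.1, xs.2) | xs <- r']); rewrite big_cat big_map /=.
congr (_ + _); rewrite -sumrN; apply: eq_bigr => -[v s] _ /=.
by rewrite opactN opprD.
Qed.

HB.instance Definition _ := GRing.isZmodClosed.Build (P n) coinv_ker coinv_ker_zmod.

Definition coinv := {ideal_quot coinv_ker}.
HB.instance Definition _ := GRing.Zmodule.on coinv.

Definition to_coinv (x : P n) : coinv := \pi_(coinv) x.

End Coinvariants.

Section GroupOf.
Variable P : augOperad.

(* The [k]-th entry is the component of arity [k.+1]. *)
Definition hatP := forall k : nat, coinv P k.+1.

(* [d] encodes the arities [n_i = (d i).+1]. *)
Definition arities m k := {d : {ffun 'I_m -> 'I_k} | (\sum_i (d i).+1)%N == k}.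

(* In arity [k.+1], only the operations of arity [m.+1 <= k.+1] contribute: the
   sum of [m.+1] positive arities is at least [m.+1]. *)
Definition hatmul (x y : hatP) : hatP := fun k =>
  \sum_(m < k.+1) \sum_(d : arities m.+1 k.+1)
    to_coinv (opgamma (n := fun i => (val d i).+1) (eqP (valP d))
      (generic_quotient.repr (x m))
      (fun i => generic_quotient.repr (y (val d i)))).

Definition hatone : hatP := fun k =>
  match k with 0%N => to_coinv (opunit P) | _ => 0 end.

Definition hatinvertible (x : hatP) :=
  exists y, hatmul x y = hatone /\ hatmul y x = hatone.

Definition hatG := {x : hatP | `[< hatinvertible x >]}.

End GroupOf.

(** The operad Mu *)

Section InputNumbering.
Variables (m : nat) (n : 'I_m -> nat) (k : nat) (e : (\sum_i n i)%N = k).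

Lemma inp_surj (a : 'I_k) : exists i (j : 'I_(n i)), a = inp e j.
Proof.
case: k / e a => a; exists (tagnat.sig1 a), (tagnat.sig2 a).
exact/val_inj/(esym (congr1 val (tagnat.sig2K a))).
Qed.

Definition inp_sig (a : 'I_k) : {i & 'I_(n i)} :=
  tagnat.sig (cast_ord (esym e) a).

Lemma inpK i (j : 'I_(n i)) : inp_sig (inp e j) = Tagged (fun i => 'I_(n i)) j.
Proof. by rewrite /inp_sig /inp cast_ordK tagnat.rankK. Qed.

Lemma inp_bij : bijective (fun p : {i & 'I_(n i)} => inp e (tagged p)).
Proof.
exists inp_sig => [[i j]|a]; first by rewrite inpK.
by have [i [j ->]] := inp_surj a; rewrite inpK.
Qed.

Lemma big_inp (R : Type) (idx : R) (op : Monoid.com_law idx) (F : 'I_k -> R) :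
  \big[op/idx]_a F a = \big[op/idx]_i \big[op/idx]_(j < n i) F (inp e j).
Proof.
rewrite (reindex _ (onW_bij _ inp_bij)) (sig_big_dep _ _ (fun i j => F (inp e j))) /=.
by [].
Qed.

Lemma eq_inp i (j : 'I_(n i)) i' (j' : 'I_(n i')) :
  (inp e j == inp e j') = (Tagged (fun i => 'I_(n i)) j == Tagged _ j').
Proof.
rewrite -!inpK (can_eq (g := fun p => inp e (tagged p))) // => a.
by have [? [? ->]] := inp_surj a; rewrite inpK.
Qed.

Lemma eq_inp1 i (j j' : 'I_(n i)) : (inp e j == inp e j') = (j == j').
Proof. by rewrite eq_inp eq_Tagged. Qed.
End InputNumbering.

Lemma inp_lt m (n : 'I_m -> nat) k (e : (\sum_i n i)%N = k)
    i (j : 'I_(n i)) i' (j' : 'I_(n i')) :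
  (i < i')%N -> (inp e j < inp e j')%N.
Proof.
move=> ii'; rewrite !inpE; apply: leq_trans (leq_addr _ _).
apply: (@leq_trans (\sum_(h < m | (h < i)%N) n h + n i)).
  by rewrite ltn_add2l.
rewrite [leqRHS](bigID [pred h : 'I__ | (h < i)%N])/=; apply: leq_add.
  rewrite [leqRHS](eq_bigl [pred h : 'I_m | (h < i)%N])// => h /=.
  by case: (ltnP h i); rewrite ?andbF// => /ltn_trans->.
by rewrite (bigD1 i) ?ltnn ?ii' //= leq_addr.
Qed.

Lemma inpA m (n : 'I_m -> nat) k (e : (\sum_i n i)%N = k)
    (p : 'I_k -> nat) l (ep : (\sum_a p a)%N = l)
    (r : 'I_m -> nat) (er : forall i, (\sum_j p (inp e (i := i) j))%N = r i)
    (e' : (\sum_i r i)%N = l) i (j : 'I_(n i)) (b : 'I_(p (inp e j))) :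
  inp ep b = inp e' (inp (er i) b).
Proof.
apply/ord_inj; rewrite [LHS]inpE [RHS]inpE [in RHS]inpE addnA; congr addn.
rewrite big_mkcond (big_inp e) (bigID (fun h : 'I_m => (h < i)%N)).
congr addn.
  apply: eq_bigr => h hi; rewrite -er; apply: eq_bigr => j' _.
  by rewrite ifT // inp_lt.
rewrite (bigD1 i) ?ltnn // -[RHS]addn0; congr addn; last first.
  apply: big1 => h /andP[hi hni]; apply: big1 => j' _; rewrite ifF //.
  apply/negbTE; rewrite -leqNgt ltnW //; apply: inp_lt.
  by rewrite ltn_neqAle eq_sym hni leqNgt.
rewrite [RHS]big_mkcond; apply: eq_bigr => j' _.
by rewrite !inpE ltn_add2l.
Qed.

(* [delta_mx 0 i : 'rV_n] is the basis element mu^n_(i+1), the corolla with [n]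
   vertices and root [i]. Its composite with [y_0, .., y_(n-1)] vanishes unless
   every [y_h] with [h != i] has arity 1, hence is [mu_scal (y h)] times the
   unit; [mu_scal] is 0 in the other arities. See [Mu_circ] and [Mu_circ0] for
   the partial composites. *)
Definition mu_scal n (v : 'rV[rat]_n) : rat :=
  if n == 1%N then \sum_j v 0 j else 0.

Definition mu_gamma m (n : 'I_m -> nat) k (e : (\sum_i n i)%N = k)
    (x : 'rV[rat]_m) (y : forall i, 'rV[rat]_(n i)) : 'rV[rat]_k :=
  \row_a let i := tag (inp_sig e a) in
    x 0 i * y i 0 (tagged (inp_sig e a)) * \prod_(h | h != i) mu_scal (y h).

Definition mu_act n (x : 'rV[rat]_n) (s : 'S_n) : 'rV[rat]_n :=
  col_perm s^-1 x.

Definition mu_unit : 'rV[rat]_1 := const_mx 1.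

Lemma mu_gammaE m n k (e : (\sum_(i < m) n i)%N = k) x y i (j : 'I_(n i)) :
  mu_gamma e x y 0 (inp e j) = x 0 i * y i 0 j * \prod_(h | h != i) mu_scal (y h).
Proof. by rewrite mxE inpK. Qed.

Lemma row_inpP m n k (e : (\sum_(i < m) n i)%N = k) (u v : 'rV[rat]_k) :
  (forall i (j : 'I_(n i)), u 0 (inp e j) = v 0 (inp e j)) -> u = v.
Proof.
move=> uv; apply/rowP => a; have [i [j ->]] := inp_surj e a; exact: uv.
Qed.

Lemma mu_scal_linear n a (x y : 'rV[rat]_n) :
  mu_scal (a *: x + y) = a * mu_scal x + mu_scal y.
Proof.
rewrite /mu_scal; case: eqP => _; last by rewrite mulr0 addr0.
by rewrite mulr_sumr -big_split; apply: eq_bigr => j _; rewrite !mxE.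
Qed.

Lemma mu_scal_gamma m n k (e : (\sum_(i < m) n i)%N = k) x y :
  mu_scal (mu_gamma e x y) = mu_scal x * \prod_i mu_scal (y i).
Proof.
rewrite {1}/mu_scal (big_inp e).
have -> : \sum_i \sum_(j < n i) mu_gamma e x y 0 (inp e j) =
    \sum_i x 0 i * (\sum_j y i 0 j) * \prod_(h | h != i) mu_scal (y h).
  apply: eq_bigr => i _; rewrite mulr_sumr mulr_suml; apply: eq_bigr => j _.
  exact: mu_gammaE.
have [m1|m1] := eqVneq m 1%N.
  subst m; rewrite !big_ord1 /mu_scal eqxx big_ord1 /= -e big_ord1.
  rewrite (@big_pred0 _ _ *%R) ?mulr1; last by move=> h; rewrite [h]ord1 eqxx.
  by case: ifP => //; rewrite mulr0.
rewrite {2}/mu_scal (negbTE m1) mul0r; case: ifP => // /eqP k1.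
rewrite big1 // => i _.
case: (posnP (n i)) => [ni0|ni0].
  rewrite (big1 _ _ (fun j => y i 0 j)) ?mulr0 ?mul0r // => j _.
  by have lt0 := leq_ltn_trans (leq0n j) (ltn_ord j); rewrite ni0 in lt0.
have m2 : (1 < m)%N by case: m m1 i {n e x y ni0} => [|[|]] // _ [].
have [h hi] : exists h : 'I_m, h != i.
  exists (if i == Ordinal m2 then Ordinal (ltnW m2) else Ordinal m2).
  by case: ifP => [/eqP-> //|]; rewrite eq_sym => ->.
rewrite (bigD1 h) //= [X in X * \prod_(_ < _ | _) _]/mu_scal ifF ?mul0r ?mulr0 //.
apply/negbTE; apply/eqP => nh; move: e; rewrite k1 (bigD1 i) //= (bigD1 h) //= nh.
by case: (n i) ni0 => // q _; rewrite add1n addnS addSn.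
Qed.

Lemma linear_mxE m n a (u v : 'M[rat]_(m, n)) i j :
  (a *: u + v) i j = a * u i j + v i j.
Proof. by rewrite !mxE. Qed.

Fact mu_act_linear n a (x y : 'rV[rat]_n) s :
  mu_act (a *: x + y) s = a *: mu_act x s + mu_act y s.
Proof. by apply/rowP=> j; rewrite !mxE. Qed.

Lemma mu_actE n (x : 'rV[rat]_n) (s : 'S_n) i : mu_act x s 0 (s i) = x 0 i.
Proof. by rewrite mxE permK. Qed.

Fact mu_act1 n (x : 'rV[rat]_n) : mu_act x 1%g = x.
Proof. by rewrite /mu_act invg1 col_perm1. Qed.

Fact mu_actM n (x : 'rV[rat]_n) s t : mu_act x (s * t)%g = mu_act (mu_act x s) t.
Proof. by apply/rowP=> j; rewrite !mxE invMg permM. Qed.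

Fact mu_gamma_linearl m n k (e : (\sum_(i < m) n i)%N = k) a x x' y :
  mu_gamma e (a *: x + x') y = a *: mu_gamma e x y + mu_gamma e x' y.
Proof.
apply: (@row_inpP _ _ _ e) => i j.
by rewrite linear_mxE !mu_gammaE !mxE !mulrDl !mulrA.
Qed.

Fact mu_gamma_linearr m n k (e : (\sum_(i < m) n i)%N = k)
    i0 a x (y y1 y2 : forall i, 'rV[rat]_(n i)) :
  (forall i, i != i0 -> y i = y1 i /\ y i = y2 i) ->
  y i0 = a *: y1 i0 + y2 i0 ->
  mu_gamma e x y = a *: mu_gamma e x y1 + mu_gamma e x y2.
Proof.
move=> y12 yi0; apply: (@row_inpP _ _ _ e) => i j.
rewrite linear_mxE !mu_gammaE.
have [ii0 | ii0] := eqVneq i i0; first subst i0.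
  rewrite yi0 !mxE.
  have E : forall w : forall i, 'rV[rat]_(n i), (forall h, h != i -> y h = w h) ->
    \prod_(h | h != i) mu_scal (y h) = \prod_(h | h != i) mu_scal (w h).
    by move=> w yw; apply: eq_bigr => h /yw->.
  rewrite -(E y1) -1?(E y2); try by move=> h /y12[].
  by rewrite mulrDr mulrDl; congr (_ + _); rewrite !mulrA (mulrC a).
have [<- <-] := y12 _ ii0.
rewrite (bigD1 i0) 1?eq_sym //= [in RHS](bigD1 i0) 1?eq_sym //=.
rewrite [X in _ = _ + _ * X](bigD1 i0) 1?eq_sym //= yi0 mu_scal_linear.
have E : forall w : forall i, 'rV[rat]_(n i), (forall h, h != i0 -> y h = w h) ->
    \prod_(h | (h != i) && (h != i0)) mu_scal (y h) =
    \prod_(h | (h != i) && (h != i0)) mu_scal (w h).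
  by move=> w yw; apply: eq_bigr => h /andP[_ /yw->].
rewrite -(E y1) -1?(E y2); try by move=> h /y12[].
by rewrite mulrDl mulrDr -(mulrA a) mulrCA.
Qed.

Fact mu_gamma_unitl k (e : (\sum_(i < 1) k)%N = k) (y : 'rV[rat]_k) :
  mu_gamma (n := fun=> k) e mu_unit (fun=> y) = y.
Proof.
apply: (@row_inpP _ _ _ e) => i j; rewrite mu_gammaE mxE mul1r.
rewrite big_pred0 ?mulr1; last by move=> h; rewrite [h]ord1 [i]ord1 eqxx.
congr (y 0 _); apply/ord_inj; rewrite inpE big_pred0 // => h.
by rewrite [h]ord1 [i]ord1.
Qed.

Lemma mu_scal_unit : mu_scal mu_unit = 1.
Proof. by rewrite /mu_scal eqxx big_ord1 mxE. Qed.

Fact mu_gamma_unitr m (e : (\sum_(i < m) 1)%N = m) (x : 'rV[rat]_m) :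
  mu_gamma (n := fun=> 1%N) e x (fun=> mu_unit) = x.
Proof.
apply: (@row_inpP _ _ _ e) => i j; rewrite mu_gammaE mxE mulr1 mu_scal_unit.
rewrite big1_eq mulr1; congr (x 0 _); apply/ord_inj; rewrite inpE /= [j]ord1 addn0.
by rewrite -(big_ord_widen m (fun=> 1%N) (ltnW (ltn_ord i))) sum_nat_const card_ord
  muln1.
Qed.

Fact mu_gammaA m (n : 'I_m -> nat) k (e : (\sum_i n i)%N = k)
    (p : 'I_k -> nat) l (ep : (\sum_a p a)%N = l)
    (r : 'I_m -> nat) (er : forall i, (\sum_j p (inp e (i := i) j))%N = r i)
    (e' : (\sum_i r i)%N = l) x y (z : forall a, 'rV[rat]_(p a)) :
  mu_gamma ep (mu_gamma e x y) z =
  mu_gamma e' x (fun i => mu_gamma (er i) (y i) (fun j => z (inp e j))).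
Proof.
apply: (@row_inpP _ _ _ ep) => a; have [i [j ->{a}]] := inp_surj e a => b.
rewrite mu_gammaE (inpA ep er e') !mu_gammaE -!mulrA; do 2 congr (_ * _).
rewrite mulrCA; congr (_ * _).
have -> : \prod_(a | a != inp e j) mu_scal (z a) =
    \prod_(j' | j' != j) mu_scal (z (inp e j')) *
    \prod_(h | h != i) \prod_(j' < n h) mu_scal (z (inp e j')).
  rewrite big_mkcond (big_inp e) (bigD1 i) //; congr (_ * _).
    by rewrite [RHS]big_mkcond; apply: eq_bigr => j' _; rewrite eq_inp1.
  apply: eq_bigr => h hi; apply: eq_bigr => j' _.
  by rewrite ifT // eq_inp -tag_eqE /tag_eq /= (negbTE hi).
rewrite mulrCA; congr (_ * _); rewrite -big_split; apply: eq_bigr => h hi.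
by rewrite mu_scal_gamma.
Qed.

Fact mu_gamma_actl m (n : 'I_m -> nat) k (e : (\sum_i n i)%N = k)
    (s : 'S_m) (es : (\sum_i n (s i))%N = k) (u : 'S_k) x
    (y : forall i, 'rV[rat]_(n i)) :
  (forall i (j : 'I_(n (s i))), u (inp es (i := i) j) = inp e j) ->
  mu_gamma e (mu_act x s) y = mu_act (mu_gamma es x (fun i => y (s i))) u.
Proof.
move=> us; apply/rowP => a; rewrite -[a](permKV u).
have [i [j ->]] := inp_surj es (u^-1%g a).
rewrite mu_actE us !mu_gammaE mu_actE; congr (_ * _).
rewrite (reindex_inj (@perm_inj _ s)); apply: eq_bigl => h.
by rewrite (inj_eq (@perm_inj _ s)).
Qed.

Fact mu_gamma_actr m (n : 'I_m -> nat) k (e : (\sum_i n i)%N = k)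
    (t : forall i, 'S_(n i)) (u : 'S_k) x (y : forall i, 'rV[rat]_(n i)) :
  (forall i (j : 'I_(n i)), u (inp e j) = inp e (t i j)) ->
  mu_gamma e x (fun i => mu_act (y i) (t i)) = mu_act (mu_gamma e x y) u.
Proof.
move=> ut; apply/rowP => a; rewrite -[a](permKV u).
have [i [j ->]] := inp_surj e (u^-1%g a).
rewrite mu_actE ut !mu_gammaE mu_actE; congr (_ * _).
apply: eq_bigr => h _; rewrite /mu_scal; case: ifP => // _.
rewrite (reindex_inj (@perm_inj _ (t h))); apply: eq_bigr => q _.
by rewrite mu_actE.
Qed.

Definition mu_operad : operad :=
  @Operad (fun n => 'rV[rat]_n) mu_act mu_unit mu_gamma mu_act_linear mu_act1
    mu_actM mu_gamma_linearl mu_gamma_linearr mu_gamma_unitl mu_gamma_unitr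
    mu_gammaA mu_gamma_actl mu_gamma_actr.

Fact mu_aug0 (x : mu_operad 0) : x = 0.
Proof. exact: thinmx0. Qed.

Fact mu_aug1 (x : mu_operad 1) : exists a, x = a *: opunit mu_operad.
Proof.
by exists ((x : 'rV_1) 0 0); apply/rowP => i; rewrite !mxE mulr1 [i]ord1.
Qed.

Fact mu_unit_neq0 : opunit mu_operad != 0.
Proof. by apply/eqP => /rowP/(_ 0); rewrite !mxE => /eqP; rewrite oner_eq0. Qed.

Definition Mu : augOperad := AugOperad mu_aug0 mu_aug1 mu_unit_neq0.

Definition mu n (i : 'I_n) : Mu n := delta_mx 0 i.

Lemma mu_unitE : mu (0 : 'I_1) = opunit Mu.
Proof. by apply/rowP => i; rewrite !mxE [i]ord1. Qed.

Lemma opact_mu n (i : 'I_n) (s : 'S_n) : opact (mu i) s = mu (s i).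
Proof.
apply/rowP => j; rewrite !mxE /=.
by rewrite -(inj_eq (@perm_inj _ s)) permKV.
Qed.

(* In 0-based numbering, [i + j] stands for the [i + j - 1] of 1-based
   numbering. *)
Lemma Mu_circ m (i : 'I_m) l (j : 'I_l) k (e : (\sum_h opins i l h)%N = k)
    (a : 'I_k) :
  a = (i + j)%N :> nat -> opcirc e (mu i) (mu j) = mu a.
Proof.
move=> aE; have opinsi : l = opins i l i by rewrite /opins eqxx.
have {aE}-> : a = inp e (cast_ord opinsi j).
  apply/ord_inj; rewrite inpE aE; congr (_ + _)%N.
  rewrite (eq_bigr (fun=> 1%N)); last first.
    by move=> h hi; rewrite /opins ifF // -val_eqE ltn_eqF.
  by rewrite -(big_ord_widen m (fun=> 1%N) (ltnW (ltn_ord i))) sum_nat_const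
    card_ord muln1.
rewrite /opcirc; apply: (@row_inpP _ _ _ e) => i1 j1; rewrite mu_gammaE !mxE eqxx /=.
have [ii1|ii1] : i1 = i \/ i1 != i by case: (eqVneq i1 i); [left | right].
  2: {
    have d0 : (i1 == i)%:R = 0 :> rat by rewrite (negbTE ii1).
    by rewrite d0 !mul0r eq_inp -tag_eqE /tag_eq /= (negbTE ii1). }
subst i1; have d1 : (i == i)%:R = 1 :> rat by rewrite eqxx.
rewrite eq_inp1 d1 mul1r big1 ?mulr1.
  rewrite (_ : (j1 == cast_ord opinsi j) = (j1 == j :> nat)) //.
  move: (eqxx i) j1; rewrite {opinsi}/opins.
  by case: (i == i) => // _ j1; rewrite mxE.
move=> h /negbTE; rewrite /opins; case: (h == i) => // _.
exact: mu_scal_unit.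
Qed.

Lemma Mu_circ0 m (i h : 'I_m) l (j : 'I_l) k (e : (\sum_q opins h l q)%N = k) :
  h != i -> (1 < l)%N -> opcirc e (mu i) (mu j) = 0.
Proof.
move=> hi l1; rewrite /opcirc; apply: (@row_inpP _ _ _ e) => i1 j1.
rewrite mu_gammaE !mxE eqxx /=.
have [ii1|ii1] : i1 = i \/ i1 != i by case: (eqVneq i1 i); [left | right].
  2: by have d0 : (i1 == i)%:R = 0 :> rat; [rewrite (negbTE ii1) | rewrite d0 !mul0r].
subst i1; rewrite (bigD1 h) //= [X in _ * (X * _)](_ : _ = 0) ?mul0r ?mulr0 //.
rewrite /opins; move: (eqxx h); case: (h == h) => // _.
by rewrite /mu_scal ifF //; case: l l1 {j e j1} => [|[|]].
Qed.

(** The semi-direct product *)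

(* The power series [\sum_n f_n x^n] is given by its coefficients. *)
Definition fps := nat -> rat.

Definition fps_one : fps := fun n => (n == 0%N)%:R.

Definition fps_mul (f g : fps) : fps :=
  fun n => \sum_(i < n.+1) f i * g (n - i)%N.

Definition fps_subst (a : rat) (f : fps) : fps := fun n => a ^+ n * f n.

Lemma fps_mul_poly N (f g : fps) n : (n < N)%N ->
  fps_mul f g n = ((\poly_(i < N) f i) * (\poly_(i < N) g i))`_n.
Proof.
move=> nN; rewrite coefM; apply: eq_bigr => i _; rewrite !coef_poly.
by rewrite (leq_trans (ltn_ord i)) // (leq_ltn_trans (leq_subr i n)).
Qed.

Lemma fps_mulC f g : fps_mul f g = fps_mul g f.
Proof. by apply: funext => n; rewrite !(@fps_mul_poly n.+1) // mulrC. Qed.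

Lemma fps_mulA f g h : fps_mul f (fps_mul g h) = fps_mul (fps_mul f g) h.
Proof.
have key u v w n : fps_mul u (fps_mul v w) n = ((\poly_(i < n.+1) u i) *
    ((\poly_(i < n.+1) v i) * (\poly_(i < n.+1) w i)))`_n.
  rewrite coefM; apply: eq_bigr => i _; rewrite coef_poly ltn_ord; congr (_ * _).
  by rewrite (@fps_mul_poly n.+1) // ltnS leq_subr.
by apply: funext => n; rewrite [in RHS]fps_mulC !key mulrA mulrC.
Qed.

Lemma fps_mul1 f : fps_mul fps_one f = f.
Proof.
apply: funext => n; rewrite /fps_mul big_ord_recl /= mul1r subn0 big1 ?addr0 //.
by move=> i _; rewrite mul0r.
Qed.

Lemma fps_substM a f g :
  fps_subst a (fps_mul f g) = fps_mul (fps_subst a f) (fps_subst a g).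
Proof.
apply: funext => n; rewrite /fps_subst /fps_mul mulr_sumr.
apply: eq_bigr => i _; rewrite mulrACA -exprD subnKC //.
by rewrite -ltnS ltn_ord.
Qed.

Lemma fps_subst_comp a b f : fps_subst a (fps_subst b f) = fps_subst (a * b) f.
Proof. by apply: funext => n; rewrite /fps_subst exprMn mulrA. Qed.

Lemma fps_subst1 f : fps_subst 1 f = f.
Proof. by apply: funext => n; rewrite /fps_subst expr1n mul1r. Qed.

Fixpoint fps_inv_seq (f : fps) (n : nat) : seq rat :=
  if n is n'.+1 then
    let s := fps_inv_seq f n' in
    rcons s (fps_one n' - \sum_(i < n') f (n' - i)%N * s`_i)
  else [::].

Definition fps_inv (f : fps) : fps := fun n => (fps_inv_seq f n.+1)`_n.

Lemma size_fps_inv_seq f n : size (fps_inv_seq f n) = n.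
Proof. by elim: n => //= n IHn; rewrite size_rcons IHn. Qed.

Lemma nth_fps_inv_seq f n i : (i < n)%N -> (fps_inv_seq f n)`_i = fps_inv f i.
Proof.
elim: n => // n IHn; rewrite ltnS leq_eqVlt => /predU1P[-> //|i_lt_n].
by rewrite /= nth_rcons size_fps_inv_seq i_lt_n IHn.
Qed.

Lemma fps_mulV f : f 0%N = 1 -> fps_mul (fps_inv f) f = fps_one.
Proof.
move=> f0; apply: funext => n; rewrite /fps_mul big_ord_recr /= subnn f0 mulr1.
rewrite {2}/fps_inv /= nth_rcons size_fps_inv_seq ltnn eqxx addrC.
rewrite [X in _ + X](eq_bigr (fun i : 'I_n => f (n - i)%N * (fps_inv_seq f n)`_i)).
  by rewrite subrK.
by move=> i _; rewrite nth_fps_inv_seq // mulrC.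
Qed.

(* The group [1 + x Q[[x]]] *)
Definition G1 := {f : fps | f 0%N == 1}.

HB.instance Definition _ := gen_eqMixin G1.
HB.instance Definition _ := gen_choiceMixin G1.

Lemma G1_inj (f g : G1) : sval f = sval g -> f = g.
Proof. exact: val_inj. Qed.

Fact G1_one_subproof : fps_one 0%N == 1. Proof. by []. Qed.

Fact G1_mul_subproof (f g : G1) : fps_mul (sval f) (sval g) 0%N == 1.
Proof.
by rewrite /fps_mul big_ord1 subnn (eqP (svalP f)) (eqP (svalP g)) mulr1.
Qed.

Fact G1_inv_subproof (f : G1) : fps_inv (sval f) 0%N == 1.
Proof. by rewrite /fps_inv /= big_ord0 subr0. Qed.

Fact G1_subst_subproof (a : rat) (f : G1) : fps_subst a (sval f) 0%N == 1.
Proof. by rewrite /fps_subst mul1r (eqP (svalP f)). Qed.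

Definition G1_one : G1 := exist (fun f : fps => f 0%N == 1) _ G1_one_subproof.
Definition G1_mul (f g : G1) : G1 :=
  exist (fun f : fps => f 0%N == 1) _ (G1_mul_subproof f g).
Definition G1_inv (f : G1) : G1 :=
  exist (fun f : fps => f 0%N == 1) _ (G1_inv_subproof f).

Fact G1_mulA : associative G1_mul.
Proof. by move=> f g h; apply: G1_inj; rewrite /= fps_mulA. Qed.
Fact G1_mul1g : left_id G1_one G1_mul.
Proof. by move=> f; apply: G1_inj; rewrite /= fps_mul1. Qed.
Fact G1_mulg1 : right_id G1_one G1_mul.
Proof. by move=> f; apply: G1_inj; rewrite /= fps_mulC fps_mul1. Qed.
Fact G1_mulVg : left_inverse G1_one G1_inv G1_mul.
Proof. by move=> f; apply: G1_inj; rewrite /= fps_mulV // (eqP (svalP f)). Qed.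
Fact G1_mulgV : right_inverse G1_one G1_inv G1_mul.
Proof.
by move=> f; apply: G1_inj; rewrite /= fps_mulC fps_mulV // (eqP (svalP f)).
Qed.

HB.instance Definition _ :=
  isGroup.Build G1 G1_mulA G1_mul1g G1_mulg1 G1_mulVg G1_mulgV.

(* The group [Q^*] *)
Definition G2 := {a : rat | a != 0}.

HB.instance Definition _ := gen_eqMixin G2.
HB.instance Definition _ := gen_choiceMixin G2.

Lemma G2_inj (a b : G2) : sval a = sval b -> a = b.
Proof. exact: val_inj. Qed.

Fact G2_one_subproof : 1 != 0 :> rat. Proof. by []. Qed.
Fact G2_mul_subproof (a b : G2) : sval a * sval b != 0.
Proof. by rewrite mulf_neq0 ?(svalP a) ?(svalP b). Qed.
Fact G2_inv_subproof (a : G2) : (sval a)^-1 != 0.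
Proof. by rewrite invr_eq0 (svalP a). Qed.

Definition G2_one : G2 := exist (fun a : rat => a != 0) _ G2_one_subproof.
Definition G2_mul (a b : G2) : G2 :=
  exist (fun a : rat => a != 0) _ (G2_mul_subproof a b).
Definition G2_inv (a : G2) : G2 :=
  exist (fun a : rat => a != 0) _ (G2_inv_subproof a).

Fact G2_mulA : associative G2_mul.
Proof. by move=> a b c; apply: G2_inj; rewrite /= mulrA. Qed.
Fact G2_mul1g : left_id G2_one G2_mul.
Proof. by move=> a; apply: G2_inj; rewrite /= mul1r. Qed.
Fact G2_mulg1 : right_id G2_one G2_mul.
Proof. by move=> a; apply: G2_inj; rewrite /= mulr1. Qed.
Fact G2_mulVg : left_inverse G2_one G2_inv G2_mul.
Proof. by move=> a; apply: G2_inj; rewrite /= mulVf // (svalP a). Qed.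
Fact G2_mulgV : right_inverse G2_one G2_inv G2_mul.
Proof. by move=> a; apply: G2_inj; rewrite /= mulfV // (svalP a). Qed.

HB.instance Definition _ :=
  isGroup.Build G2 G2_mulA G2_mul1g G2_mulg1 G2_mulVg G2_mulgV.

Definition G1_act (a : G2) (f : G1) : G1 :=
  exist (fun f : fps => f 0%N == 1) _ (G1_subst_subproof (sval a) f).

Lemma G1_act1 f : G1_act 1%g f = f.
Proof. by apply: G1_inj; rewrite /= fps_subst1. Qed.

Lemma G1_actA a b f : G1_act a (G1_act b f) = G1_act (a * b)%g f.
Proof. by apply: G1_inj; rewrite /= fps_subst_comp. Qed.

Lemma G1_actM a (f g : G1) : G1_act a (f * g)%g = (G1_act a f * G1_act a g)%g.
Proof. by apply: G1_inj; rewrite /= fps_substM. Qed.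

Lemma G2_mulC (a b : G2) : (a * b)%g = (b * a)%g.
Proof. by apply: G2_inj; rewrite /= mulrC. Qed.

Lemma G1_act_one a : G1_act a 1%g = 1%g.
Proof. by apply: (mulgI (G1_act a 1%g)); rewrite -G1_actM !mulg1. Qed.

(* [sdG a f] is the element [(a, f)] of the semi-direct product. *)
Record sdG := SdG { sd_fst : G2; sd_snd : G1 }.

HB.instance Definition _ := gen_eqMixin sdG.
HB.instance Definition _ := gen_choiceMixin sdG.

Definition sd_one : sdG := SdG 1%g 1%g.
Definition sd_mul (u v : sdG) : sdG :=
  SdG (sd_fst u * sd_fst v)%g (G1_act (sd_fst v) (sd_snd u) * sd_snd v)%g.
Definition sd_inv (u : sdG) : sdG :=
  SdG (sd_fst u)^-1%g (G1_act (sd_fst u)^-1%g (sd_snd u)^-1%g).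

Fact sd_mulA : associative sd_mul.
Proof.
move=> [a f] [b g] [c h]; rewrite /sd_mul /= mulgA G1_actM G1_actA mulgA.
by rewrite (G2_mulC c).
Qed.
Fact sd_mul1g : left_id sd_one sd_mul.
Proof. by move=> [a f]; rewrite /sd_mul /= mul1g G1_act_one mul1g. Qed.
Fact sd_mulg1 : right_id sd_one sd_mul.
Proof. by move=> [a f]; rewrite /sd_mul /= !mulg1 G1_act1. Qed.
Fact sd_mulVg : left_inverse sd_one sd_inv sd_mul.
Proof.
by move=> [a f]; rewrite /sd_mul /= mulVg G1_actA mulgV G1_act1 mulVg.
Qed.
Fact sd_mulgV : right_inverse sd_one sd_inv sd_mul.
Proof.
by move=> [a f]; rewrite /sd_mul /= mulgV -G1_actM mulgV G1_act_one.
Qed.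

HB.instance Definition _ :=
  isGroup.Build sdG sd_mulA sd_mul1g sd_mulg1 sd_mulVg sd_mulgV.

(* Main.v *)
Require Import Defs.
From mathcomp Require Import all_boot all_fingroup all_algebra.
From mathcomp Require Import ring_quotient boolp.

(** The symmetric group permutes the corollas of a given arity transitively, so
each space of coinvariants of [Mu] is a line, with coordinate the sum of the
coefficients on the corollas ([to_coinv_mu_eq]). An element of the completion
[hatP Mu] is therefore a sequence of rationals, read as the power series whose
coefficient of [t^k] is the coordinate in arity [k.+1].

The composite of a corolla with [y_0, .., y_m] is nonzero only if every [y_h]
has arity 1, except possibly the [y_i] inserted at the root. Once the arity of the
composite is fixed, the arity of that [y_i] is determined, and each of the [m]
other arguments contributes the constant coefficient [b] of the second series
([sum_arities]). So the product of the series [F] and [H] is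
[sum_m F_m b^m t^m H(t) = F(b t) H(t)] ([coefs_mul]).

A series with nonzero constant coefficient is uniquely [a f] with [a] in [Q^*]
and [f] in [1 + x Q[[x]]], and the product of [a f] and [b g] is
[a b f(b t) g(t)]: this is the product of [(a, f)] and [(b, g)] in the
semi-direct product ([hatmul_sd]). It remains to see that the invertible
elements are those with nonzero constant coefficient. This is necessary because
constant coefficients multiply, and sufficient because the semi-direct product
is a group. *)

Set Implicit Arguments.
Unset Strict Implicit.
Unset Printing Implicit Defensive.

Import GRing.Theory.
Local Open Scope ring_scope.
Local Open Scope quotient_scope.

Section CoinvTheory.
Variables (P : operad) (n : nat).

Lemma to_coinv_eqP (x y : P n) :
  reflect (exists r : seq (P n * 'S_n),
             x - y = \sum_(xs <- r) (opact xs.1 xs.2 - xs.1))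
          (to_coinv x == to_coinv y).
Proof.
by rewrite /to_coinv -[_ == _]Quotient.idealrBE; apply: asboolP.
Qed.

Lemma to_coinvD (x y : P n) : to_coinv (x + y) = to_coinv x + to_coinv y.
Proof. exact: (raddfD (\pi_{ideal_quot @coinv_ker P n})). Qed.

Lemma to_coinv0 : to_coinv (0 : P n) = 0.
Proof. exact: (raddf0 (\pi_{ideal_quot @coinv_ker P n})). Qed.

Lemma to_coinv_repr (c : coinv P n) : to_coinv (generic_quotient.repr c) = c.
Proof. exact: generic_quotient.reprK. Qed.

End CoinvTheory.

Definition coefsum n (v : 'rV[rat]_n) : rat := \sum_j v 0 j.

Lemma coefsumB n (u v : 'rV[rat]_n) : coefsum (u - v) = coefsum u - coefsum v.
Proof. by rewrite /coefsum -sumrB; apply: eq_bigr => j _; rewrite !mxE. Qed.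

Lemma coefsumD n (u v : 'rV[rat]_n) : coefsum (u + v) = coefsum u + coefsum v.
Proof. by rewrite /coefsum -big_split; apply: eq_bigr => j _; rewrite !mxE. Qed.

Lemma coefsum0 n : coefsum (0 : 'rV[rat]_n) = 0.
Proof. by rewrite /coefsum big1 // => j _; rewrite mxE. Qed.

Lemma coefsum_act n (v : 'rV[rat]_n) (s : 'S_n) :
  coefsum (mu_act v s) = coefsum v.
Proof.
rewrite /coefsum (reindex_inj (@perm_inj _ s)).
by apply: eq_bigr => j _; rewrite mu_actE.
Qed.

Lemma coefsum_gamma m (n : 'I_m -> nat) k (e : (\sum_i n i)%N = k)
    (x : 'rV[rat]_m) (y : forall i, 'rV[rat]_(n i)) :
  coefsum (mu_gamma e x y) =
  \sum_i x 0 i * (coefsum (y i) * \prod_(h | h != i) mu_scal (y h)).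
Proof.
rewrite /coefsum (big_inp e); apply: eq_bigr => i _.
rewrite mulr_suml mulr_sumr; apply: eq_bigr => j _.
by rewrite mu_gammaE mulrA.
Qed.

Lemma coefsum_delta n (i : 'I_n) a : coefsum (a *: delta_mx 0 i) = a.
Proof.
rewrite /coefsum (bigD1 i) //= big1 => [|j ji]; rewrite !mxE ?eqxx ?mulr1 ?addr0 //.
by rewrite (negbTE ji) mulr0.
Qed.

(** The action preserves the sum of the coefficients. Conversely, an element of
sum 0 is a combination of differences of a corolla and the corolla of root [0],
and these differ by a transposition. *)
Lemma to_coinv_mu_eq n (u v : Mu n.+1) :
  (to_coinv u == to_coinv v) = (coefsum u == coefsum v).
Proof.
apply/to_coinv_eqP/eqP => [[r uv]|uv].
  apply/eqP; rewrite -subr_eq0 -coefsumB [X in coefsum X]uv.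
  elim: r {uv} => [|[x s] r IHr]; first by rewrite big_nil coefsum0.
  by rewrite big_cons coefsumD (eqP IHr) addr0 coefsumB coefsum_act subrr.
(* As the coefficients of [w] add up to 0, it is the sum over [j] of
     [w_j (mu_j - mu_0)]. *)
pose w : 'rV[rat]_n.+1 := u - v.
exists [seq (w 0 j *: delta_mx 0 0 : Mu n.+1, tperm 0 j) | j <- enum 'I_n.+1].
rewrite big_map big_enum /= sumrB -[u - v]/w.
have act_root (j : 'I_n.+1) a :
    mu_act (a *: delta_mx 0 0) (tperm 0 j) = a *: delta_mx 0 j.
  apply/rowP => h; rewrite !mxE tpermV /=; congr (_ * (_ : bool)%:R).
  by rewrite -(inj_eq (@perm_inj _ (tperm 0 j))) tpermK tpermL.
under eq_bigr do rewrite act_root.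
rewrite -scaler_suml (_ : \sum_j w 0 j = 0) ?scale0r ?subr0.
  exact: row_sum_delta.
by rewrite -[LHS]/(coefsum w) coefsumB; apply/eqP; rewrite subr_eq0 uv.
Qed.

(** The power series attached to an element of the completion. The [k]-th
coefficient lives in arity [k.+1], so that the unit becomes the series 1. *)
Definition coefs (x : hatP Mu) : fps := fun k => coefsum (generic_quotient.repr (x k)).

Definition of_coefs (f : fps) : hatP Mu :=
  fun k => to_coinv (f k *: delta_mx 0 0 : Mu k.+1).

Lemma coefs_to_coinv k (x : hatP Mu) (v : Mu k.+1) :
  x k = to_coinv v -> coefs x k = coefsum v.
Proof.
by move=> xk; apply/eqP; rewrite -to_coinv_mu_eq to_coinv_repr xk.
Qed.

Lemma of_coefsK : cancel of_coefs coefs.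
Proof.
by move=> f; apply: funext => k; rewrite (coefs_to_coinv (erefl _)) coefsum_delta.
Qed.

Lemma coefsK : cancel coefs of_coefs.
Proof.
move=> x; apply: functional_extensionality_dep => k; apply/eqP.
by rewrite -[x k]to_coinv_repr to_coinv_mu_eq coefsum_delta.
Qed.

Lemma coefs_one : coefs (@hatone Mu) = fps_one.
Proof.
apply: funext => -[|k]; rewrite /fps_one /=.
  by rewrite (coefs_to_coinv (erefl _)) /coefsum big_ord1 mxE.
rewrite (@coefs_to_coinv _ _ 0) ?coefsum0 ?to_coinv0 //.
Qed.

(** With [a] the coordinates of the second factor, the summand is the
contribution of the root [i] to the product: the other [m] arguments must be in
arity 1, which leaves [k - m] as the only possible shifted arity of the [i]-th
one. *)
Lemma sum_arities (a : nat -> rat) m k (i : 'I_m.+1) : (m <= k)%N ->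
  \sum_(d : arities m.+1 k.+1)
     a (val d i) * \prod_(h | h != i) (if val d h == 0%N :> nat then a 0%N else 0)
  = a 0%N ^+ m * a (k - m)%N.
Proof.
move=> mk.
have sum1 : (\sum_(h < m.+1 | h != i) 1 = m)%N.
  by rewrite sum1_card cardC1 card_ord.
pose f0 : {ffun 'I_m.+1 -> 'I_k.+1} :=
  [ffun h => if h == i then inord (k - m) else 0].
have f0i : f0 i = (k - m)%N :> nat.
  by rewrite ffunE eqxx inordK // ltnS leq_subr.
have f0N h : h != i -> f0 h = 0%N :> nat by rewrite ffunE => /negbTE ->.
have f0P : (\sum_h (f0 h).+1)%N == k.+1.
  rewrite (bigD1 i) //= f0i (eq_bigr (fun=> 1%N)) => [|h /f0N -> //].
  by rewrite sum1 addSn subnK.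
rewrite (bigD1 (exist _ f0 f0P : arities _ _)) //= f0i.
rewrite [X in _ + X]big1 => [|[d dP] /= dN].
  rewrite addr0 (eq_bigr (fun=> a 0%N)) => [|h /f0N -> //].
  by rewrite prodr_const cardC1 card_ord mulrC.
have [h /andP[hi dh]] : exists h, (h != i) && (d h != 0%N :> nat).
  apply/existsP; apply: contraR dN => /existsPn d0; apply/eqP/val_inj => /=.
  have {}d0 h : h != i -> d h = 0%N :> nat.
    by move=> hi; have := d0 h; rewrite hi /= negbK => /eqP.
  apply/ffunP => h; apply/ord_inj; have [->|hi] := eqVneq h i; last first.
    by rewrite d0 // f0N.
  rewrite f0i; move: dP; rewrite (bigD1 i) //= (eq_bigr (fun=> 1%N)).
    by rewrite sum1 addSn eqSS => /eqP dik; rewrite -[in RHS]dik addnK.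
  by move=> h' /d0 ->.
by rewrite (bigD1 h) //= (negbTE dh) mul0r mulr0.
Qed.

(** With [H] the series of [y] and [b] its constant coefficient, the product
turns the series [F(t)] into [F(b t) H(t)]: by [sum_arities], each choice of
root in [x m] gives [b^m H_(k - m)], so that only the sum of the coefficients
of [x m] is left. *)
Lemma coefs_mul (x y : hatP Mu) :
  coefs (hatmul x y) = fps_mul (fps_subst (coefs y 0%N) (coefs x)) (coefs y).
Proof.
(* [mu_scal] sees the coefficient sum in arity 1 and vanishes above. *)
have scal_repr k : mu_scal (generic_quotient.repr (y k)) =
    if k == 0%N then coefs y 0%N else 0.
  by case: k.
apply: funext => k; rewrite (coefs_to_coinv (v := \sum_(m < k.+1)
    \sum_(d : arities m.+1 k.+1)
      mu_gamma (n := fun i => (val d i).+1) (eqP (valP d))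
        (generic_quotient.repr (x m))
        (fun i => generic_quotient.repr (y (val d i))))); last first.
  rewrite (big_morph _ (@to_coinvD Mu k.+1) (@to_coinv0 Mu k.+1)).
  apply: eq_bigr => m _.
  by rewrite (big_morph _ (@to_coinvD Mu k.+1) (@to_coinv0 Mu k.+1)).
rewrite (big_morph _ (@coefsumD _) (@coefsum0 _)); apply: eq_bigr => m _.
rewrite (big_morph _ (@coefsumD _) (@coefsum0 _)).
under eq_bigr do rewrite coefsum_gamma.
rewrite exchange_big /= [fps_subst _ _ _]mulrC /= -mulrA mulr_suml.
apply: eq_bigr => i _; rewrite -mulr_sumr; congr (_ * _).
rewrite -(sum_arities (coefs y) i (ltn_ord m)).
apply: eq_bigr => d _; congr (_ * _); apply: eq_bigr => h _.
exact: scal_repr.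
Qed.

Lemma coefs_invertible_neq0 (x : hatP Mu) : hatinvertible x -> coefs x 0%N != 0.
Proof.
move=> [y [xy _]]; apply/eqP => x0.
have := congr1 (fun z => coefs z 0%N) xy.
rewrite /= coefs_mul coefs_one /fps_mul big_ord1 /fps_subst x0 mulr0 mul0r.
by move/eqP; rewrite eq_sym oner_eq0.
Qed.

Definition sd_coefs (u : sdG) : fps :=
  fun k => sval (sd_fst u) * sval (sd_snd u) k.

Lemma sd_coefs0 u : sd_coefs u 0%N = sval (sd_fst u).
Proof. by rewrite /sd_coefs (eqP (svalP (sd_snd u))) mulr1. Qed.

(** The substitution in [coefs_mul] is at the constant coefficient of the
second factor, which for [b g] is [b]: the twist [f(b t)] of the semi-direct
product. *)
Lemma hatmul_sd (u v : sdG) :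
  hatmul (of_coefs (sd_coefs u)) (of_coefs (sd_coefs v)) =
  of_coefs (sd_coefs (u * v)%g).
Proof.
apply: (can_inj coefsK); rewrite coefs_mul !of_coefsK sd_coefs0.
apply: funext => k; rewrite /sd_coefs /= /fps_mul mulr_sumr.
apply: eq_bigr => i _; rewrite /fps_subst.
by rewrite (mulrCA _ (sval (sd_fst u))) mulrACA.
Qed.

Lemma sd_one_coefs : of_coefs (sd_coefs 1%g) = @hatone Mu.
Proof.
apply: (can_inj coefsK); rewrite of_coefsK coefs_one.
by apply: funext => k; rewrite /sd_coefs /= mul1r.
Qed.

(** The inverse comes from the semi-direct product, which is known to be a
group. *)
Lemma sd_invertible (u : sdG) : hatinvertible (of_coefs (sd_coefs u)).
Proof.
by exists (of_coefs (sd_coefs u^-1%g)); rewrite !hatmul_sd mulgV mulVg sd_one_coefs.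
Qed.

Definition sd_to_hatG (u : sdG) : hatG Mu :=
  exist (fun x => `[< hatinvertible x >]) _ (asboolT (sd_invertible u)).

Fact hatG_lead_subproof (x : hatG Mu) : coefs (sval x) 0%N != 0.
Proof. exact: coefs_invertible_neq0 (asboolW (svalP x)). Qed.

Fact hatG_normal_subproof (x : hatG Mu) :
  coefs (sval x) 0%N / coefs (sval x) 0%N == 1.
Proof. by rewrite divff // hatG_lead_subproof. Qed.

Definition hatG_to_sd (x : hatG Mu) : sdG :=
  SdG (exist (fun a : rat => a != 0) _ (hatG_lead_subproof x))
      (exist (fun f : fps => f 0%N == 1)
        (fun k => coefs (sval x) k / coefs (sval x) 0%N) (hatG_normal_subproof x)).

Lemma sd_to_hatGK : cancel sd_to_hatG hatG_to_sd.
Proof.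
move=> [a f]; congr SdG.
  by apply: G2_inj; rewrite /= of_coefsK sd_coefs0.
apply: G1_inj; apply: funext => k.
by rewrite /= of_coefsK sd_coefs0 /sd_coefs mulrAC divff ?mul1r // (svalP a).
Qed.

Lemma hatG_to_sdK : cancel hatG_to_sd sd_to_hatG.
Proof.
move=> x; apply: val_inj; apply: (can_inj coefsK); rewrite of_coefsK.
by apply: funext => k; rewrite /sd_coefs /= mulrC divfK // hatG_lead_subproof.
Qed.

Theorem proposition9 :
  exists phi : sdG -> hatG Mu,
    bijective phi /\
    forall u v : sdG,
      sval (phi (u * v)%g) = hatmul (sval (phi u)) (sval (phi v)).
Proof.
exists sd_to_hatG; split; first exact: Bijective sd_to_hatGK hatG_to_sdK.
by move=> u v; rewrite /= hatmul_sd.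
Qed.
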